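(* For every constant $a \ge 1$ there is a constant $C_a$ such that the following holds. Let $q$ be a prime power, $k \ge 4$, $0<\varepsilon<1$, and let $\mathcal{C} \subseteq \mathbb{F}_q^n$ be an (unweighted) linear code of dimension $k$ and length $n \le k^{a}$. Then $\mathcal{C}$ has a $(1\pm\varepsilon)$-sparsifier of size at most $C_a \cdot k \log_2^2(k) \log_2(q) (\log_2\log_2 k)^2/\varepsilon^2$.
   Context: $\mathrm{wt}(v)$ is the number of nonzero coordinates of $v$. A $(1\pm\varepsilon)$-sparsifier of size $s$ for a code $\mathcal{C}\subseteq\mathbb{F}_q^n$ is a subset $S\subseteq[n]$, $|S|\le s$, with nonnegative weights $(w'_i)_{i\in S}$ such that for every $v\in\mathcal{C}$, $(1-\varepsilon)\mathrm{wt}(v)\le \sum_{i\in S: v_i\ne 0} w'_i \le (1+\varepsilon)\mathrm{wt}(v)$. *)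

(* Defs.v *)
From HB Require Import structures.
From mathcomp Require Import all_boot all_order all_algebra.
From mathcomp Require Import all_classical all_reals.
From mathcomp Require Import exp.
From mathcomp Require Import Rstruct.
Set Implicit Arguments. Unset Strict Implicit. Unset Printing Implicit Defensive.
Import Order.TTheory GRing.Theory Num.Theory.
Local Open Scope ring_scope.

Notation RR := Rdefinitions.R.

Definition log2 (x : RR) : RR := ln x / ln 2.

Definition wt (F : fieldType) (n : nat) (v : 'rV[F]_n) : nat :=
  #|[set i : 'I_n | v 0 i != 0]|.

Definition is_sparsifier (F : fieldType) (n : nat) (C : {vspace 'rV[F]_n})
    (eps s : RR) (S : {set 'I_n}) (w : 'I_n -> RR) : Prop :=
  (#|S|%:R <= s) /\
  (forall i, i \in S -> 0 <= w i) /\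
  (forall v, v \in C ->
     (1 - eps) * (wt v)%:R <= \sum_(i in S | v 0 i != 0) w i /\
     \sum_(i in S | v 0 i != 0) w i <= (1 + eps) * (wt v)%:R).

Definition has_sparsifier (F : fieldType) (n : nat) (C : {vspace 'rV[F]_n})
    (eps s : RR) : Prop :=
  exists (S : {set 'I_n}) (w : 'I_n -> RR), is_sparsifier C eps s S w.

(* Main.v *)
Require Import Defs.
From HB Require Import structures.
From mathcomp Require Import all_boot all_order all_algebra.
From mathcomp Require Import all_field.
From mathcomp Require Import all_classical all_reals.
From mathcomp Require Import sequences exp.
From mathcomp Require Import Rstruct.
From mathcomp Require Import zify ring lra.
Import Order.TTheory GRing.Theory Num.Theory.
Local Open Scope ring_scope.
Set Implicit Arguments. Unset Strict Implicit. Unset Printing Implicit Defensive.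

(** Counting: call a code [d]-dense if each of its [j]-dimensional subcodes has
support at least [d * j].  Every code becomes [d]-dense after deleting at most
[d * k] coordinates, and the contraction argument of Karger (shorten the code at
a random coordinate of its support) shows that a [d]-dense code has at most
[(k * q) ^ a] words of weight at most [a * d].

Sampling: let [d = L * N] with [L] of order [ln (k * q) / del ^ 2].  Keeping each
coordinate of a [d]-dense code with probability [1 / N] preserves all weights
up to a factor [1 +- del], after rescaling by [N].

Recursion: a code of length [m ^ 2 * k * L] splits, with [N] of order [m], into
the deleted coordinates and the sample, which both have length of order
[m * k * L] and are again unweighted up to a global scale.  Since [n <= k ^ a],
about [log2 (log2 k)] rounds suffice; they produce about [log2 k] pieces of
length of order [k * L], and [del = eps / (2 t)] keeps the total error after [t]
rounds below [eps]. *)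

(** * Dense codes and the number of their light words *)

Lemma leq_bin_exp (n m : nat) : ('C(n, m) <= n ^ m)%N.
Proof.
elim: m => [|m IH]; first by rewrite bin0.
apply: (@leq_trans (m.+1 * 'C(n, m.+1))); first exact: leq_pmull.
by rewrite mul_bin_left expnS leq_mul ?leq_subr.
Qed.

Section CountingLightWords.
Context {F : finFieldType} {n : nat}.
Implicit Types (v : 'rV[F]_n) (C D E : {vspace 'rV[F]_n}) (A B : {set 'I_n}).

Definition supp v : {set 'I_n} := [set i | v 0 i != 0].

Definition vsupp D : {set 'I_n} := \bigcup_(v in D) supp v.

(** Puncturing is encoded as zeroing the coordinates outside [B], so all restricted codes stay in
    one ambient space. *)
Definition restr B : 'End('rV[F]_n) :=
  linfun (mulmxr (diag_mx (\row_i (i \in B)%:R))).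

Definition dense (d : nat) D :=
  forall E, (E <= D)%VS -> (d * \dim E <= #|vsupp E|)%N.

Lemma restrE B v i : restr B v 0 i = if i \in B then v 0 i else 0.
Proof.
by rewrite lfunE /= mul_mx_diag !mxE; case: (i \in B); rewrite ?mulr1 ?mulr0.
Qed.

Lemma supp_restr B v : supp (restr B v) = supp v :&: B.
Proof.
apply/setP => i; rewrite !inE restrE.
by case: (i \in B); rewrite ?eqxx ?andbT ?andbF.
Qed.

Lemma supp_eq0 v : (supp v == finset.set0) = (v == 0).
Proof.
apply/eqP/eqP => [s0|->]; last by apply/setP => i; rewrite !inE mxE eqxx.
apply/rowP => i; rewrite mxE; apply/eqP.
by move/setP/(_ i): s0; rewrite !inE => /negbFE.
Qed.

Lemma supp_sub D v : v \in D -> supp v \subset vsupp D.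
Proof. by move=> vD; apply: (bigcup_max v). Qed.

Lemma restr_eq0 B v : (restr B v == 0) = [disjoint supp v & B].
Proof. by rewrite -supp_eq0 supp_restr setI_eq0. Qed.

(** The intersection with this kernel is the shortening of [D] at [i], to which the counting
    induction descends. *)
Lemma mem_hyperplane D i v :
  (v \in (D :&: lker (restr [set i]))%VS) = (v \in D) && (v 0 i == 0).
Proof.
rewrite memv_cap memv_ker restr_eq0; congr (_ && _).
by rewrite disjoint_sym disjoints1 inE negbK.
Qed.

Lemma dim_hyperplane D i :
  i \in vsupp D -> (\dim (D :&: lker (restr [set i])) < \dim D)%N.
Proof.
case/bigcupP => v vD; rewrite inE => vi.
rewrite ltn_neqAle dimvS ?capvSl // andbT.
apply: contra vi => /eqP dE.
have /eqP eqD : (D :&: lker (restr [set i]) == D)%VS.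
  by rewrite eqEdim capvSl dE /=.
by move: vD; rewrite -eqD mem_hyperplane => /andP[].
Qed.

Lemma card_light_words_bin (d a m : nat) D : (0 < d)%N -> dense d D ->
  (\dim D <= a + m)%N ->
  (#|[set v in D | (#|supp v| <= a * d)%N]| <= 'C(a + m, a) * #|F| ^ a)%N.
Proof.
move=> d0; elim: m D => [|m IH] D dD.
  rewrite addn0 binn mul1n => dimD.
  apply: (@leq_trans #|D|).
    by apply/subset_leq_card/fintype.subsetP => v; rewrite inE => /andP[].
  rewrite card_vspace leq_exp2l //; exact: finNzRing_gt1.
rewrite leq_eqVlt => /orP[/eqP dimD|]; last first.
  rewrite addnS ltnS => dimD; apply: leq_trans (IH _ dD dimD) _.
  by rewrite leq_mul2r leq_bin2l ?orbT // leq_add2l.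
set W := [set v in D | _].
set Q := (#|F| ^ a)%N; set b := 'C(a + m, a).
set s := #|vsupp D|.
have sD : (d * (a + m.+1) <= s)%N by rewrite -dimD; exact: dD.
have s0 : (0 < s)%N by apply: leq_trans sD; rewrite muln_gt0 d0 addnS.
(* double count the pairs of a light word [v] and a zero of [v] in [vsupp D]:
   the light words vanishing at [i] form a code of smaller dimension *)
have count : (#|W| * s <= #|W| * (a * d) + s * (b * Q))%N.
  have -> : (#|W| * s = \sum_(v in W) #|supp v| +
      \sum_(v in W) #|vsupp D :\: supp v|)%N.
    rewrite -big_split /= -sum_nat_const; apply: eq_bigr => v.
    rewrite inE => /andP[/supp_sub sv _].
    by rewrite /s -(cardsID (supp v) (vsupp D)) (finset.setIidPr sv).
  apply: leq_add.
    by rewrite -sum_nat_const; apply: leq_sum => v; rewrite inE => /andP[].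
  have -> : (\sum_(v in W) #|vsupp D :\: supp v| =
      \sum_(i in vsupp D) #|[set v in W | v 0%R i == 0%R]|)%N.
    under eq_bigr do rewrite -sum1_card.
    rewrite (exchange_big_dep (mem (vsupp D))) /=; last first.
      by move=> v i _; rewrite inE => /andP[].
    apply: eq_bigr => i iD; rewrite -sum1_card; apply: eq_bigl => v.
    by rewrite !inE iD negbK andbT.
  rewrite /s -sum_nat_const; apply: leq_sum => i iD.
  apply: leq_trans (IH (D :&: lker (restr [set i]))%VS _ _).
  - apply/subset_leq_card/fintype.subsetP => v; rewrite !inE mem_hyperplane.
    by case/andP=> /andP[-> ->] ->.
  - by move=> E ED; apply: dD; apply: subv_trans ED (capvSl _ _).
  - by rewrite -ltnS -addnS -dimD; exact: dim_hyperplane.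
(* [count] reads [|W| (s - a d) <= s b Q], and [sD] gives [a d <= a s / (a + m + 1)]. Hence
   [(m + 1) |W| <= (a + m + 1) b Q], which [binE] turns into the next binomial coefficient. *)
have binE := mul_bin_down (a + m.+1) a.
rewrite addKn addnS /= -/b in binE.
rewrite -(@leq_pmul2l m.+1) // mulnA addnS -binE -addnS.
rewrite -(@leq_pmul2r s) //.
rewrite -(leq_add2l (#|W| * a * s)).
have := leq_mul (leqnn (a + m.+1)) count.
have := leq_mul (leqnn (#|W| * a)) sD.
nia.
Qed.

(** For [a <= k] the binomial coefficient is at most [k ^ a]; for [a > k] counting all words of [D]
    suffices. *)
Lemma card_light_words (d a k : nat) D : (0 < d)%N -> (0 < k)%N -> dense d D ->
  (\dim D <= k)%N ->
  (#|[set v in D | (#|supp v| <= a * d)%N]| <= (k * #|F|) ^ a)%N.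
Proof.
move=> d0 k0 dD dimD; case: (leqP a k) => ak.
  rewrite -(subnKC ak) in dimD *.
  apply: leq_trans (card_light_words_bin d0 dD dimD) _.
  rewrite expnMn leq_mul2r; apply/orP; right.
  exact: leq_bin_exp.
apply: (@leq_trans #|D|).
  by apply/subset_leq_card/fintype.subsetP => v; rewrite inE => /andP[].
rewrite card_vspace expnMn; apply: (@leq_trans (#|F| ^ a)).
  by rewrite leq_exp2l ?finNzRing_gt1 //; apply: leq_trans dimD (ltnW ak).
by rewrite leq_pmull // expn_gt0 k0.
Qed.
Lemma restr_comp A B v : restr A (restr B v) = restr (A :&: B) v.
Proof. by apply/rowP => i; rewrite !restrE inE; case: (i \in A). Qed.

Lemma exists_dense_restriction (d : nat) C A :
  exists B : {set 'I_n}, [/\ B \subset A, dense d (restr B @: C)%VS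
    & (#|A :\: B| <= d * \dim C)%N].
Proof.
(* a subcode of the minimiser violating density could be removed at a gain *)
pose f B := (d * \dim (restr B @: C) + #|A :\: B|)%N.
have [B BA minB] := @arg_minnP _ A (fun B => B \subset A) f (subxx A).
(* The deletion bound compares the minimiser with [A] itself, where nothing is deleted. *)
exists B; split=> //; last first.
  apply: (@leq_trans (f B)); first exact: leq_addl.
  apply: leq_trans (minB A (subxx A)) _.
  rewrite /f finset.setDv cards0 addn0 leq_mul2l -(limg_ker_dim (restr A) C).
  by rewrite leq_addl orbT.
move=> E ED; set X := vsupp E; pose B' := B :\: X.
have := minB B' (fintype.subset_trans (subsetDl _ _) BA); rewrite /f.
have -> : (restr B' @: C = restr B' @: (restr B @: C))%VS.
  rewrite -limg_comp; congr (_ @: _)%VS; apply/lfunP => v.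
  by rewrite comp_lfunE restr_comp (finset.setIidPl _) // subsetDl.
set D := (restr B @: C)%VS.
(* [B'] avoids the support of [E], so [E] lies in the kernel of [restr B'] and rank-nullity
   applies. *)
have dimE : (\dim E + \dim (restr B' @: D) <= \dim D)%N.
  rewrite -(limg_ker_dim (restr B') D) leq_add2r; apply: dimvS.
  rewrite subv_cap ED; apply/subvP => v vE; rewrite memv_ker restr_eq0.
  rewrite disjoint_sym finset.disjoints_subset; apply/fintype.subsetP => i.
  rewrite !inE => /andP[iX _]; apply: contra iX => vi.
  by apply: (fintype.subsetP (supp_sub vE)); rewrite inE.
have cardA : (#|A :\: B'| <= #|A :\: B| + #|X|)%N.
  apply: leq_trans (leq_card_setU _ _); apply/subset_leq_card/fintype.subsetP => i.
  by rewrite !inE; case: (i \in X); case: (i \in B); rewrite ?orbT //= orbF.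
have := leq_mul (leqnn d) dimE; rewrite mulnDr.
lia.
Qed.

Lemma dense_supp (d : nat) D v :
  dense d D -> v \in D -> v != 0 -> (d <= #|supp v|)%N.
Proof.
move=> dD vD v0; have := dD <[v]>%VS; rewrite -memvE dim_vline v0 muln1 => /(_ vD) h.
apply: leq_trans h _; apply/subset_leq_card/bigcupsP => u /vlineP[c ->].
by apply/fintype.subsetP => i; rewrite !inE mxE mulf_eq0 negb_or => /andP[].
Qed.

(** This is the failure total for the union bound over words. Grouped by [j], the weight divided by
    [d] and rounded down, level [j] contributes at most [8^-j]; level 0 is empty by [dense_supp],
    and [1/7] is the geometric sum from [j = 1]. *)
Lemma sum_expR_dense (d k : nat) (lam : RR) D :
  (0 < d)%N -> (0 < k)%N -> (8 <= k * #|F|)%N -> dense d D -> (\dim D <= k)%N ->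
  0 <= lam -> (k * #|F|)%:R ^+ 4 * expR (- (lam * d%:R)) <= 1 ->
  \sum_(v in D | v != 0) expR (- (lam * #|supp v|%:R)) <= 7^-1.
Proof.
set K := (k * #|F|)%N => d0 k0 K8 dD dimD lam0.
set x := expR _ => Kx.
have x0 : 0 < x by exact: expR_gt0.
have K0 : 0 < K%:R :> RR by rewrite ltr0n; lia.
have ratio : K%:R ^+ 2 * x <= 8^-1.
  have K2 : 8 <= K%:R ^+ 2 :> RR by rewrite -natrX ler_nat; nia.
  rewrite -(ler_pM2l (exprn_gt0 2 K0)) mulrA -exprD.
  apply: le_trans Kx _; lra.
pose p (v : 'rV[F]_n) : 'I_n.+1 := inord (#|supp v| %/ d).
have pE v : p v = (#|supp v| %/ d)%N :> nat.
  rewrite inordK // ltnS; apply: leq_trans (leq_div _ _) _.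
  by rewrite -[X in (_ <= X)%N]card_ord max_card.
rewrite (partition_big p (fun j => 0 < j)%N) /=; last first.
  by move=> v /andP[vD v0]; rewrite pE divn_gt0 // (dense_supp dD).
(* at most [K ^ (j + 1) <= K ^ (2 j)] words have weight in [[j d, (j + 1) d)] *)
apply: (@le_trans _ _ (\sum_(j < n.+1 | (0 < j)%N) 8^-1 ^+ j)).
  apply: ler_sum => j j0.
  apply: (@le_trans _ _ (\sum_(v in [set v in D | (#|supp v| <= j.+1 * d)%N]) x ^+ j)).
    rewrite [leRHS]big_mkcond [leLHS]big_mkcond; apply: ler_sum => v _.
    case: ifP => [/andP[/andP[vD v0] /eqP pv]|_]; last first.
      by case: ifP => // _; rewrite exprn_ge0 // ltW.
    have pjE : (j : nat) = (#|supp v| %/ d)%N by rewrite -pv pE.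
    rewrite inE vD /= pjE ltnW ?ltn_ceil //.
    rewrite /x -expRM_natl ler_expR mulrN lerN2 mulrCA.
    by rewrite ler_wpM2l // -natrM ler_nat leq_trunc_div.
  rewrite sumr_const -[leLHS]mulr_natl.
  apply: (@le_trans _ _ ((K%:R ^+ 2 * x) ^+ j)); last first.
    by rewrite lerXn2r // nnegrE ?invr_ge0 // mulr_ge0 ?sqr_ge0 // ltW.
  rewrite exprMn; apply: ler_wpM2r; first by rewrite exprn_ge0 // ltW.
  rewrite -exprM -natrX ler_nat.
  apply: leq_trans (card_light_words _ d0 k0 dD dimD) _.
  by rewrite leq_pexp2l //; lia.
rewrite big_mkcond big_ord_recl /= add0r.
have geo m : \sum_(i < m) (8^-1 : RR) ^+ (lift ord0 i) = 7^-1 * (1 - 8^-1 ^+ m).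
  elim: m => [|m IH]; first by rewrite big_ord0 expr0 subrr mulr0.
  rewrite big_ord_recr /= /bump /= in IH *; rewrite IH add1n exprS; lra.
rewrite geo ler_piMr ?invr_ge0 // lerBlDr lerDl.
by rewrite exprn_ge0 // invr_ge0.
Qed.

End CountingLightWords.

(** * Chernoff bounds for independent sampling *)

(** Compare both sides after multiplying by [1 - x > 0]: the left becomes at most 1 because
    [expR (- x) >= 1 - x], the right at least 1. *)
Lemma expR_le_quadratic (x : RR) : x <= 2^-1 -> expR x <= 1 + x + 2 * x ^+ 2.
Proof.
move=> x2; have := expR_ge1Dx (- x); rewrite expRN => h.
have e0 := expR_gt0 x.
have h1 : (1 - x) * expR x <= 1.
  by rewrite -[leRHS](mulVf (lt0r_neq0 e0)) ler_pM2r.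
have h2 : 1 <= (1 - x) * (1 + x + 2 * x ^+ 2).
  have -> : (1 - x) * (1 + x + 2 * x ^+ 2) = 1 + x ^+ 2 * (1 - 2 * x) by ring.
  by rewrite lerDl mulr_ge0 ?sqr_ge0 //; lra.
rewrite -(@ler_pM2l _ (1 - x)) ?(le_trans h1) //; lra.
Qed.

Section Sampling.
Context {T : finType}.
Implicit Types (J X : {set T}).

(** The probability of drawing exactly [J] when each point is kept independently with probability
    [p]; expectations are finite sums against it. *)
Definition bernoulli_mass (p : RR) J : RR := \prod_i (if i \in J then p else 1 - p).

Lemma sum_bernoulli_mass p : \sum_J bernoulli_mass p J = 1.
Proof.
transitivity (\prod_(i : T) (p + (1 - p))); first by rewrite bigA_distr.
by apply: big1 => i _; rewrite addrC subrK.
Qed.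

(** By independence the moment generating function is a product, and each factor [1 + p (e^th - 1)]
    is at most [exp (p (e^th - 1))]. *)
Lemma bernoulli_mgf (p th : RR) X : 0 <= p <= 1 ->
  \sum_J bernoulli_mass p J * expR (th * #|J :&: X|%:R) <=
  expR (p * #|X|%:R * (expR th - 1)).
Proof.
move=> /andP[p0 p1]; pose y i := if i \in X then expR th else 1.
have -> : \sum_J bernoulli_mass p J * expR (th * #|J :&: X|%:R) =
    \prod_i (p * y i + (1 - p)).
  rewrite bigA_distr; apply: eq_bigr => J _.
  have -> : expR (th * #|J :&: X|%:R) = \prod_i (if i \in J then y i else 1).
    rewrite mulrC expRM_natl -prodr_const big_mkcond; apply: eq_bigr => i _.
    by rewrite inE /y; case: (i \in J).
  rewrite -big_split /=; apply: eq_bigr => i _.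
  by case: ifP => _; rewrite ?mulr1.
rewrite mulrAC mulrC expRM_natl -prodr_const [leRHS]big_mkcond.
apply: ler_prod => i _; rewrite /y; case: ifP => _; last first.
  by rewrite mulr1 addrC subrK ler01 lexx.
have e0 := expR_gt0 th.
have -> : p * expR th + (1 - p) = 1 + p * (expR th - 1) by ring.
rewrite expR_ge1Dx andbT.
have := mulr_ge0 p0 (ltW e0); lra.
Qed.

Lemma exists_good_sample (p del : RR) (XX : seq {set T}) :
  0 <= p <= 1 -> 0 < del < 1 ->
  \sum_(X <- XX) 2 * expR (- (del ^+ 2 * p / 8 * #|X|%:R)) < 1 ->
  exists J, forall X, X \in XX ->
    (1 - del) * (p * #|X|%:R) <= #|J :&: X|%:R <= (1 + del) * (p * #|X|%:R).
Proof.
move=> p01 /andP[d0 d1] small; have /andP[p0 p1] := p01.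
pose good J X := (1 - del) * (p * #|X|%:R) <= #|J :&: X|%:R
  <= (1 + del) * (p * #|X|%:R).
suff [J /allP gJ] : exists J, all (good J) XX by exists J.
apply/existsP; apply: contraT; rewrite negb_exists => /forallP bad.
(* the Chernoff exponent, for which [2 th ^ 2 - th del = - del ^ 2 / 8] *)
have [th thE] : exists th : RR, del = 4 * th by exists (del / 4); lra.
(* These exponentials are at least 1 when [J] breaks the upper or lower bound at [X]. If every [J]
   were bad, their sum over [XX] would be at least 1 everywhere, against a mean below 1. *)
pose up X J :=
  expR (th * #|J :&: X|%:R) * expR (- (th * ((1 + del) * (p * #|X|%:R)))).
pose lo X J :=
  expR (- th * #|J :&: X|%:R) * expR (th * ((1 - del) * (p * #|X|%:R))).
have mass0 J : 0 <= bernoulli_mass p J.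
  by apply: prodr_ge0 => i _; case: ifP => _ //; rewrite subr_ge0.
have ge1 J : 1 <= \sum_(X <- XX) (up X J + lo X J).
  have /allPn[X XXX gX] := bad J.
  rewrite (big_rem X) //= -[leLHS]addr0; apply: lerD; last first.
    by apply: sumr_ge0 => Y _; rewrite addr_ge0 // mulr_ge0 // expR_ge0.
  have up0 : 0 <= up X J by rewrite mulr_ge0 // expR_ge0.
  have lo0 : 0 <= lo X J by rewrite mulr_ge0 // expR_ge0.
  have th0 : 0 <= th by lra.
  move: gX; rewrite negb_and -!ltNge => /orP[] gX.
    suff : 1 <= lo X J by lra.
    rewrite /lo -exp.expRD -[leLHS]exp.expR0 ler_expR mulNr addrC subr_ge0.
    by rewrite ler_wpM2l // ltW.
  suff : 1 <= up X J by lra.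
  rewrite /up -exp.expRD -[leLHS]exp.expR0 ler_expR subr_ge0.
  by rewrite ler_wpM2l // ltW.
have : \sum_J bernoulli_mass p J * \sum_(X <- XX) (up X J + lo X J) < 1.
  under eq_bigr do rewrite mulr_sumr.
  rewrite exchange_big /=; apply: le_lt_trans small; apply: ler_sum => X _.
  under eq_bigr do
    rewrite mulrDr /up /lo 2!(mulrA (bernoulli_mass p _) (expR _) (expR _)).
  rewrite big_split /= -!mulr_suml mulr_natl mulr2n.
  have pX0 : 0 <= p * #|X|%:R by rewrite mulr_ge0.
  have [m mE] : exists m : RR, m = p * #|X|%:R by eexists.
  have -> : del ^+ 2 * p / 8 * #|X|%:R = m * (del ^+ 2 / 8) by rewrite mE; field.
  apply: lerD.
    apply: le_trans (ler_wpM2r (expR_ge0 _) (bernoulli_mgf _ _ p01)) _.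
    rewrite -exp.expRD ler_expR -mE.
    have h : expR th <= 1 + th + 2 * th ^+ 2 by apply: expR_le_quadratic; lra.
    have := ler_wpM2l pX0 h; rewrite -mE thE; lra.
  apply: le_trans (ler_wpM2r (expR_ge0 _) (bernoulli_mgf _ _ p01)) _.
  rewrite -exp.expRD ler_expR -mE.
  have h : expR (- th) <= 1 - th + 2 * th ^+ 2.
    by rewrite -[X in _ <= _ + 2 * X]sqrrN; apply: expR_le_quadratic; lra.
  have := ler_wpM2l pX0 h; rewrite -mE thE; lra.
rewrite ltNge => /negP[]; rewrite -(sum_bernoulli_mass p).
by apply: ler_sum => J _; rewrite ler_peMr.
Qed.

End Sampling.

(** * One sampling round and the recursion *)

Section Sparsify.
Context {F : finFieldType} {n : nat}.
Implicit Types (v : 'rV[F]_n) (C D : {vspace 'rV[F]_n}) (A B S : {set 'I_n}).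

Lemma exists_uniform_sample (k N L : nat) (del : RR) C B :
  (0 < N)%N -> (0 < L)%N -> (0 < k)%N -> (8 <= k * #|F|)%N -> 0 < del < 1 ->
  (\dim C <= k)%N -> dense (L * N) (restr B @: C)%VS ->
  (k * #|F|)%:R ^+ 4 * expR (- (del ^+ 2 / 8 * L%:R)) <= 1 ->
  exists S, [/\ S \subset B, (N * #|S| <= 2 * #|B|)%N &
    forall v, v \in C ->
      (1 - del) * #|supp v :&: B|%:R <= N%:R * #|supp v :&: S|%:R
        <= (1 + del) * #|supp v :&: B|%:R].
Proof.
move=> N0 L0 k0 K8 /andP[d0 d1] dimC dB KL.
set D := (restr B @: C)%VS in dB.
have NR0 : 0 < N%:R :> RR by rewrite ltr0n.
have dimD : (\dim D <= k)%N.
  by apply: leq_trans dimC; rewrite -(limg_ker_dim (restr B) C) leq_addl.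
have inD v : v \in C -> restr B v \in D by exact: memv_img.
(* Nonzero words of the restricted code have weight at least [L * N], so for smaller [B] that code
   is zero and the empty sample works. Otherwise [B] is large enough for its own Chernoff bound. *)
have [smallB|bigB] := ltnP #|B| (L * N).
  exists finset.set0; split; rewrite ?finset.sub0set ?cards0 ?muln0 // => v vC.
  have v0 : restr B v == 0.
    apply: contraTT smallB => v0; rewrite -leqNgt.
    apply: leq_trans (dense_supp dB (inD v vC) v0) _.
    by rewrite supp_restr subset_leq_card // finset.subsetIr.
  have vB : supp v :&: B = finset.set0.
    by rewrite -supp_restr (eqP v0); apply/eqP; rewrite supp_eq0.
  by rewrite finset.setI0 vB cards0 !mulr0 lexx.
pose lam := del ^+ 2 * N%:R^-1 / 8.
have lam0 : 0 <= lam by rewrite /lam !mulr_ge0 ?invr_ge0 ?sqr_ge0 // ltW.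
have lamE : lam * (L * N)%:R = del ^+ 2 / 8 * L%:R.
  by rewrite /lam natrM; field; rewrite gt_eqF.
have p01 : 0 <= (N%:R^-1 : RR) <= 1.
  by rewrite invr_ge0 ler0n /= invf_le1 // ler1n.
(* [B] joins the supports in the family so that the sample size is controlled too. The failure total
   is at most [2 (1/64 + 1/7) < 1]. *)
have := @exists_good_sample _ N%:R^-1 del
  (B :: [seq supp v | v <- enum [pred v in D | v != 0]]) p01.
rewrite d0 d1 => /(_ isT)[|J goodJ].
  rewrite big_cons big_map big_enum /=.
  have boundB : expR (- (lam * #|B|%:R)) <= 64^-1.
    apply: (@le_trans _ _ (expR (- (del ^+ 2 / 8 * L%:R)))).
      by rewrite ler_expR lerN2 -lamE ler_wpM2l // ler_nat.
    have K4 : 64 <= (k * #|F|)%:R ^+ 4 :> RR by rewrite -natrX ler_nat; nia.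
    rewrite -(@ler_pM2l _ ((k * #|F|)%:R ^+ 4)); last by lra.
    by apply: le_trans KL _; lra.
  have boundD := @sum_expR_dense F n (L * N) k lam D _ k0 K8 dB dimD lam0.
  rewrite muln_gt0 L0 N0 lamE in boundD; have {}boundD := boundD isT KL.
  have -> : \sum_(v in [pred v in D | v != 0]) 2 * expR (- (lam * #|supp v|%:R)) =
      2 * \sum_(v in D | v != 0) expR (- (lam * #|supp v|%:R)) by rewrite mulr_sumr.
  lra.
have NVK (c x : RR) : N%:R * (c * (N%:R^-1 * x)) = c * x.
  by field; rewrite gt_eqF.
exists (J :&: B); split; first exact: finset.subsetIr.
  have /andP[_] := goodJ B (mem_head _ _).
  rewrite -(ler_pM2l NR0) NVK => h.
  rewrite -(ler_nat RR) !natrM; apply: le_trans h _.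
  by rewrite ler_wpM2r //; lra.
move=> v vC; have [v0|v0] := eqVneq (restr B v) 0.
  have vB : supp v :&: B = finset.set0.
    by rewrite -supp_restr v0; apply/eqP; rewrite supp_eq0.
  by rewrite finset.setIA finset.setIAC vB finset.set0I cards0 !mulr0 lexx.
have /goodJ : supp v :&: B \in B :: [seq supp v | v <- enum [pred v in D | v != 0]].
  rewrite inE; apply/orP; right; apply/mapP.
  exists (restr B v); last by rewrite supp_restr.
  by rewrite mem_enum inE inD.
rewrite finset.setICA => /andP[lo hi].
by rewrite -(NVK (1 - del)) -(NVK (1 + del)) !(ler_pM2l NR0) lo hi.
Qed.

(** Size is counted by nonzero values of a total weight function, so approximations of disjoint
    pieces combine by addition; separate factors [lo] and [hi] let errors multiply along the
    recursion. *)
Definition approximable C A (s : nat) (lo hi : RR) :=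
  exists w : 'I_n -> RR, [/\ forall i, 0 <= w i,
    (#|[set i | w i != 0%R]| <= s)%N &
    forall v, v \in C ->
      lo * #|supp v :&: A|%:R <= \sum_(i in supp v) w i <= hi * #|supp v :&: A|%:R].

Lemma approximable_rec (k L : nat) (del : RR) C :
  (0 < L)%N -> (0 < k)%N -> (8 <= k * #|F|)%N -> 0 < del < 1 ->
  (\dim C <= k)%N ->
  (k * #|F|)%:R ^+ 4 * expR (- (del ^+ 2 / 8 * L%:R)) <= 1 ->
  forall t A, (#|A| <= 4 * k * L * 2 ^ (2 ^ t))%N ->
    approximable C A (8 * k * L * 2 ^ t) ((1 - del) ^+ t) ((1 + del) ^+ t).
Proof.
move=> L0 k0 K8 /andP[d0 d1] dimC KL; elim=> [|t IH] A cardA.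
  (* For [t = 0] the length is at most [8 k L], so all of [A] is kept with weight one. *)
  exists (fun i => (i \in A)%:R); split=> [i||]; rewrite ?ler0n //.
    apply: leq_trans (_ : #|A| <= _)%N; last by move: cardA; rewrite expn0 expn1; lia.
    apply/subset_leq_card/fintype.subsetP => i; rewrite inE.
    by case: (i \in A); rewrite ?eqxx.
  move=> v _; rewrite !expr0 !mul1r.
  suff -> : \sum_(i in supp v) (i \in A)%:R = #|supp v :&: A|%:R :> RR by rewrite lexx.
  rewrite -sum1_card natr_sum big_mkcond [RHS]big_mkcond; apply: eq_bigr => i _.
  by rewrite finset.in_setI; case: (i \in supp v); case: (i \in A).
(* Write [M = 2 ^ (2 ^ t)], so [|A| <= 4 k L M^2] and [N = 2 M]. At most [L N k = 2 k L M]
   coordinates are deleted, and the sample has at most [2 |B| / N <= 4 k L M]; both fit the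
   induction hypothesis. *)
pose N := (2 * 2 ^ (2 ^ t))%N.
have N0 : (0 < N)%N by rewrite muln_gt0 expn_gt0.
have [B [BA dB cardAB]] := exists_dense_restriction (L * N) C A.
have [|S [SB cardS apS]] := exists_uniform_sample N0 L0 k0 K8 _ dimC dB KL.
  by rewrite d0 d1.
have [|w1 [w10 cw1 ap1]] := IH (A :\: B).
  apply: leq_trans cardAB _.
  have := leq_mul (leqnn (L * N)) dimC; rewrite /N; nia.
have [|w2 [w20 cw2 ap2]] := IH S.
  have M0 : (0 < 2 ^ (2 ^ t))%N by rewrite expn_gt0.
  rewrite -(leq_pmul2l M0).
  move: cardS cardA (subset_leq_card BA); rewrite /N.
  have -> : (2 ^ (2 ^ t.+1) = 2 ^ (2 ^ t) * 2 ^ (2 ^ t))%N.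
    by rewrite -expnD addnn expnS mul2n.
  move: (2 ^ (2 ^ t))%N => M; lia.
exists (fun i => w1 i + N%:R * w2 i); split.
- by move=> i; rewrite addr_ge0 // mulr_ge0.
- apply: (@leq_trans (#|[set i | w1 i != 0%R]| + #|[set i | w2 i != 0%R]|)%N).
    apply: leq_trans (leq_card_setU _ _); apply/subset_leq_card/fintype.subsetP => i.
    rewrite !inE; apply: contraR; rewrite negb_or !negbK => /andP[/eqP-> /eqP->].
    by rewrite mulr0 addr0.
  by rewrite expnS; lia.
move=> v vC; rewrite big_split /= -mulr_sumr.
have /andP[l1 u1] := ap1 v vC; have /andP[l2 u2] := ap2 v vC.
have /andP[lS uS] := apS v vC.
have -> : #|supp v :&: A|%:R =
    #|supp v :&: (A :\: B)|%:R + #|supp v :&: B|%:R :> RR.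
  rewrite -natrD -(cardsID B (supp v :&: A)) addnC finset.setIDA -finset.setIA.
  by rewrite (finset.setIidPr BA).
have NR0 : 0 <= N%:R :> RR by [].
have x0 : 0 <= #|supp v :&: (A :\: B)|%:R :> RR by [].
have p0 : 0 <= (1 - del) ^+ t by rewrite exprn_ge0 // subr_ge0 ltW.
have q0 : 0 <= (1 + del) ^+ t by rewrite exprn_ge0 //; lra.
(* The sampled part pays one more factor [1 - del] or [1 + del]; for the deleted part that factor is
   just a weakening. *)
rewrite !exprS !mulrDr; apply/andP; split; apply: lerD.
- by apply: le_trans l1; rewrite -mulrA ler_piMl ?mulr_ge0 //; lra.
- apply: le_trans (ler_wpM2l NR0 l2); rewrite mulrCA [(1 - del) * _]mulrC -mulrA.
  exact: ler_wpM2l.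
- by apply: le_trans u1 _; rewrite -mulrA ler_peMl ?mulr_ge0 //; lra.
- apply: le_trans (ler_wpM2l NR0 u2) _; rewrite mulrCA [(1 + del) * _]mulrC -mulrA.
  exact: ler_wpM2l.
Qed.

End Sparsify.

(** * Logarithms and the choice of parameters *)

Lemma expR_log2 (x : RR) : 0 < x -> expR (log2 x * ln 2) = x.
Proof.
move=> x0; have ln2 : 0 < ln (2 : RR) by apply: ln_gt0; lra.
by rewrite /log2 divfK ?gt_eqF // lnK.
Qed.

Lemma exprn_2E (m : nat) : 2 ^+ m = expR (m%:R * ln (2 : RR)).
Proof. by rewrite expRM_natl lnK // posrE. Qed.

Lemma ler_log2 (x y : RR) : 0 < x -> x <= y -> log2 x <= log2 y.
Proof.
move=> x0 xy; have ln2 : 0 < ln (2 : RR) by apply: ln_gt0; lra.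
by rewrite /log2 ler_pM2r ?invr_gt0 // ler_ln // posrE //; lra.
Qed.

Lemma log2_ge0 (x : RR) : 1 <= x -> 0 <= log2 x.
Proof. by move=> x1; rewrite divr_ge0 ?ln_ge0 //; lra. Qed.

Lemma log2_exprn (m : nat) : log2 (2 ^+ m) = m%:R.
Proof.
have ln2 : 0 < ln (2 : RR) by apply: ln_gt0; lra.
by rewrite /log2 exprn_2E expRK mulfK // gt_eqF.
Qed.

Lemma bernoulli_inequality (x : RR) (m : nat) :
  0 <= x <= 1 -> 1 - m%:R * x <= (1 - x) ^+ m.
Proof.
move=> /andP[x0 x1]; elim: m => [|m IH]; first by rewrite mul0r subr0 expr0.
rewrite exprS; apply: le_trans (ler_wpM2l _ IH); last by lra.
have := mulr_ge0 (ler0n RR m) (sqr_ge0 x).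
by rewrite -natr1; lra.
Qed.

(** The power is at most [expR (eps / 2)], hence at most [1 + eps / 2 + eps ^+ 2 / 2]. *)
Lemma exprn_1D_le (eps : RR) (t : nat) : (0 < t)%N -> 0 < eps < 1 ->
  (1 + eps / (2 * t%:R)) ^+ t <= 1 + eps.
Proof.
move=> t0 /andP[e0 e1]; have tR : 0 < t%:R :> RR by rewrite ltr0n.
apply: (@le_trans _ _ (expR (eps / 2))).
  have -> : eps / 2 = t%:R * (eps / (2 * t%:R)) by field; rewrite gt_eqF.
  rewrite expRM_natl; apply: lerXn2r; rewrite ?nnegrE ?expR_ge0 ?expR_ge1Dx //.
  by rewrite addr_ge0 // divr_ge0 ?mulr_ge0 // ltW.
have e2 : eps / 2 <= 2^-1 by lra.
apply: le_trans (expR_le_quadratic e2) _.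
have : eps * eps <= eps * 1 by rewrite ler_pM2l // ltW.
by lra.
Qed.

Lemma recursion_depth (a : RR) (A k : nat) :
  0 <= a -> a <= 2 ^+ A -> (4 <= k)%N ->
  exists t : nat, [/\ (0 < t)%N,
    k%:R `^ a <= 2 ^+ (2 ^ t)%N,
    t%:R <= (A + 2)%:R * log2 (log2 k%:R) :> RR &
    2 ^+ t <= 2 ^+ A * (2 * log2 k%:R) :> RR].
Proof.
move=> a0 aA k4.
have kR : 4 <= k%:R :> RR by rewrite (ler_nat _ 4 k).
set l := log2 k%:R; set ll := log2 l.
have l2 : 2 <= l.
  by rewrite -[leLHS](log2_exprn 2); apply: ler_log2; rewrite ?exprn_gt0 // -natrX.
have ll1 : 1 <= ll.
  by rewrite -[leLHS](log2_exprn 1); apply: ler_log2; rewrite ?expr1.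
have ln2 : 0 < ln (2 : RR) by apply: ln_gt0; lra.
have l0 : 0 < l by lra.
have k0 : 0 < k%:R :> RR by lra.
have /truncn_itv/andP[] : 0 <= ll by lra.
set m := Num.truncn ll => mll llm.
have lE : l = expR (ll * ln 2) by rewrite expR_log2.
have lm : l <= 2 ^+ m.+1 by rewrite lE exprn_2E ler_expR ler_wpM2r // ltW.
have ml : 2 ^+ m <= l by rewrite lE exprn_2E ler_expR ler_wpM2r // ltW.
have A0 : 0 <= 2 ^+ A :> RR by rewrite exprn_ge0.
(* [2 ^ A] absorbs [a] and [2 ^ m.+1] absorbs [log2 k], so [2 ^ t >= a log2 k]. As [k >= 4] makes
   [ll >= 1], the sum [A + m + 1] is at most [(A + 2) ll]. *)
exists (A + m.+1)%N; split.
- by rewrite addnS.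
- rewrite /powR gt_eqF // exprn_2E ler_expR.
  have -> : ln k%:R = l * ln 2 by rewrite /l /log2 divfK // gt_eqF.
  rewrite mulrA natrX exprD; apply: ler_wpM2r; first exact: ltW.
  by apply: ler_pM => //; exact: ltW.
- have := ler_wpM2l (ler0n RR A) ll1.
  rewrite (natrD _ A m.+1) (natrD _ A 2) -(natr1 m) mulrDl.
  clear -ll1 mll; lra.
- by rewrite exprD exprS ler_wpM2l // ler_wpM2l.
Qed.

Lemma sampling_rate (k q t : nat) (eps : RR) :
  (4 <= k)%N -> (2 <= q)%N -> (0 < t)%N -> 0 < eps < 1 ->
  exists L : nat, [/\ (0 < L)%N,
    (k * q)%:R ^+ 4 * expR (- ((eps / (2 * t%:R)) ^+ 2 / 8 * L%:R)) <= 1 &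
    L%:R <= 257 * (log2 k%:R * log2 q%:R * t%:R ^+ 2 / eps ^+ 2) :> RR].
Proof.
move=> k4 q2 t0 /andP[e0 e1].
have kR : 4 <= k%:R :> RR by rewrite (ler_nat _ 4 k).
have qR : 2 <= q%:R :> RR by rewrite (ler_nat _ 2 q).
have tR : 1 <= t%:R :> RR by rewrite (ler_nat _ 1 t).
have ln2 : 0 < ln (2 : RR) by apply: ln_gt0; lra.
have ln2_1 : ln (2 : RR) <= 1 by apply: le_ln1Dx; lra.
set l := log2 k%:R; set lq := log2 q%:R.
have l2 : 2 <= l.
  by rewrite -[leLHS](log2_exprn 2); apply: ler_log2; rewrite ?exprn_gt0 // -natrX.
have lq1 : 1 <= lq.
  by rewrite -[leLHS](log2_exprn 1); apply: ler_log2; rewrite ?expr1.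
have lnKq : ln (k * q)%:R <= 2 * (l * lq).
  rewrite natrM lnM ?posrE; try lra.
  have -> : ln k%:R = l * ln 2 by rewrite /l /log2 divfK // gt_eqF.
  have -> : ln q%:R = lq * ln 2 by rewrite /lq /log2 divfK // gt_eqF.
  rewrite -mulrDl; apply: (@le_trans _ _ (l + lq)).
    by rewrite ler_piMr // addr_ge0; lra.
  have : 0 <= (l - 1) * (lq - 1) by apply: mulr_ge0; lra.
  by lra.
(* [y] solves [del ^+ 2 / 8 * y = 4 ln (k q)], the exponent cancelling the fourth power; [L] is the
   floor of [y] plus one. *)
pose del := eps / (2 * t%:R); pose y := 32 * ln (k * q)%:R / del ^+ 2.
have del0 : 0 < del by rewrite divr_gt0 //; lra.
have K1 : 1 <= (k * q)%:R :> RR.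
  by rewrite (ler_nat _ 1) muln_gt0 (leq_trans _ k4) // (leq_trans _ q2).
have y0 : 0 <= y by rewrite divr_ge0 ?sqr_ge0 // mulr_ge0 // ln_ge0.
have /truncn_itv/andP[] := y0; set m := Num.truncn y => my ym.
exists m.+1; split=> //.
  have K0 : 0 < (k * q)%:R :> RR by lra.
  rewrite -[X in X ^+ 4](lnK K0) -expRM_natl -exp.expRD -[leRHS]exp.expR0 ler_expR.
  have yE : 4%:R * ln (k * q)%:R = del ^+ 2 / 8 * y.
    by rewrite /y; field; rewrite gt_eqF.
  by rewrite yE subr_le0 ler_wpM2l ?divr_ge0 ?sqr_ge0 // ltW.
set z := _ / eps ^+ 2.
(* This absorbs the rounding by one: [y <= 256 z] then gives the constant 257. *)
have z1 : 1 <= z.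
  rewrite /z ler_pdivlMr ?exprn_gt0 // mul1r.
  apply: (@le_trans _ _ 1); first by rewrite exprn_ile1 // ltW.
  by rewrite -[leLHS]mulr1 ler_pM ?exprn_ege1 // -[leLHS]mulr1 ler_pM //; lra.
have yz : y <= 256 * z.
  have -> : y = 128 * (ln (k * q)%:R * (t%:R ^+ 2 / eps ^+ 2)).
    by rewrite /y /del; field; rewrite !gt_eqF //; lra.
  have -> : 256 * z = 128 * (2 * (l * lq) * (t%:R ^+ 2 / eps ^+ 2)).
    by rewrite /z; field; rewrite gt_eqF.
  by rewrite ler_wpM2l // ler_wpM2r // divr_ge0 ?sqr_ge0.
by rewrite -natr1; lra.
Qed.

(** * Fixing the constant and assembling the sparsifier *)

Theorem theorem4p7 :
  forall a : RR, 1 <= a ->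
  exists Ca : RR,
  forall (F : finFieldType) (n k : nat) (C : {vspace 'rV[F]_n}) (eps : RR),
    (4 <= k)%N -> 0 < eps -> eps < 1 ->
    \dim C = k ->
    n%:R <= k%:R `^ a ->
    has_sparsifier C eps
      (Ca * k%:R * (log2 k%:R) ^+ 2 * log2 (#|F|%:R)
          * (log2 (log2 k%:R)) ^+ 2 / eps ^+ 2).
Proof.
move=> a a1.
have [A aA] : exists A : nat, a <= 2 ^+ A.
  have a0 : 0 <= a by lra.
  exists (Num.bound a); apply: (le_trans (ltW (archi_boundP a0))).
  by rewrite -natrX ler_nat ltnW // ltn_expl.
(* The size is [8 k L 2^t]: [2^t] gives [2 * 2^A] and one [log2 k], [L] gives 257 and the other
   [log2 k], and [t^2] inside [L] gives [(A + 2)^2]. *)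
exists (16 * 257 * 2 ^+ A * (A + 2)%:R ^+ 2) => F n k C eps k4 e0 e1 dimC nk.
have e01 : 0 < eps < 1 by rewrite e0 e1.
have [t [t0 kat tll tl]] := @recursion_depth a A k ltac:(lra) aA k4.
have q2 : (2 <= #|F|)%N := finNzRing_gt1 F.
have [L [L0 KL Lub]] := sampling_rate k4 q2 t0 e01.
have tR : 1 <= t%:R :> RR by rewrite (ler_nat _ 1 t).
pose del := eps / (2 * t%:R).
have delE : t%:R * del = eps / 2 by rewrite /del; field; rewrite gt_eqF //; lra.
have del0 : 0 < del by rewrite divr_gt0 //; lra.
have del1 : del < 1 by have := ler_wpM2r (ltW del0) tR; lra.
have del01 : 0 < del < 1 by rewrite del0 del1.
have [||||w [w0 cw apw]] :=
  @approximable_rec F n k L del C L0 _ _ del01 _ KL t finset.setT.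
- exact: leq_trans k4.
- exact: (@leq_mul 4 2).
- by rewrite dimC.
- rewrite cardsT card_ord.
  have : (n <= 2 ^ (2 ^ t))%N by rewrite -(ler_nat RR) natrX; apply: le_trans nk kat.
  move=> h; apply: leq_trans h _; apply: leq_pmull.
  rewrite muln_gt0 L0 muln_gt0 andbT /=.
  exact: leq_trans k4.
exists [set i | w i != 0], w; split; last split.
- apply: (@le_trans _ _ (8 * k * L * 2 ^ t)%:R); first by rewrite ler_nat.
  rewrite !natrM natrX.
  set l := log2 k%:R in tll tl Lub *; set lq := log2 _ in Lub *.
  set ll := log2 l in tll *.
  have l0 : 0 <= l by apply: log2_ge0; rewrite (ler_nat _ 1 k) (leq_trans _ k4).
  have lq0 : 0 <= lq by apply: log2_ge0; rewrite (ler_nat _ 1 #|F|) ltnW.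
  have ub0 : 0 <= (A + 2)%:R * ll := le_trans (ler0n _ t) tll.
  have t2 : t%:R ^+ 2 <= ((A + 2)%:R * ll) ^+ 2.
    by apply: lerXn2r; rewrite ?nnegrE ?ler0n ?ub0 ?tll.
  have L2 : L%:R <= 257 * (l * lq * ((A + 2)%:R * ll) ^+ 2 / eps ^+ 2).
    apply: le_trans Lub _; rewrite ler_wpM2l // ler_wpM2r ?invr_ge0 ?sqr_ge0 //.
    by rewrite ler_wpM2l // mulr_ge0.
  have := ler_pM _ _ L2 tl; rewrite ler0n exprn_ge0 // => /(_ isT isT) Lt.
  rewrite -mulrA; apply: le_trans (ler_wpM2l _ Lt) _; first by rewrite mulr_ge0.
  by rewrite le_eqVlt; apply/orP; left; apply/eqP; field; rewrite gt_eqF.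
- by move=> i _; exact: w0.
move=> v vC; have := apw v vC; rewrite finset.setIT.
have -> : \sum_(i in [set i | w i != 0%R] | v 0 i != 0) w i = \sum_(i in supp v) w i.
  rewrite big_mkcond [RHS]big_mkcond; apply: eq_bigr => i _; rewrite !inE.
  by case: eqP => [->|] /=; [case: ifP|].
move=> /andP[lo hi]; split.
  (* Since [t del = eps / 2], the lower factor is at least [1 - eps / 2]. *)
  apply: le_trans lo; rewrite ler_wpM2r //.
  apply: le_trans (bernoulli_inequality _ _); last by rewrite !ltW.
  by rewrite delE; lra.
by apply: le_trans hi _; rewrite ler_wpM2r // exprn_1D_le.
Qed.
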